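(* Let $X$ be a (real or complex) Banach space. Then $\Phi_X(\delta)\leq\Phi_{X^*}(\delta)$ and $\Phi_X^S(\delta)\leq\Phi_{X^*}^S(\delta)$ for every $\delta\in(0,2)$.
   Context: For a (real or complex) Banach space $X\neq\{0\}$, $B_X$ and $S_X$ denote its closed unit ball and unit sphere, $X^*$ its topological dual, and $\Pi(X):=\{(x,x^* )\in X\times X^* : \|x\|=\|x^*\|=x^*(x)=1\}$. The Bishop-Phelps-Bollobás modulus $\Phi_X:(0,2)\to[0,\infty)$ is defined as follows: $\Phi_X(\delta)$ is the infimum of those $\varepsilon>0$ such that for every $(x,x^* )\in B_X\times B_{X^*}$ with $\operatorname{Re} x^*(x)>1-\delta$ there is $(y,y^* )\in\Pi(X)$ with $\|x-y\|<\varepsilon$ and $\|x^*-y^*\|<\varepsilon$. The spherical Bishop-Phelps-Bollobás modulus $\Phi_X^S:(0,2)\to[0,\infty)$ is defined in the same way with $B_X\times B_{X^*}$ replaced by $S_X\times S_{X^*}$. Banach spaces are assumed non-zero. *)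

(* Defs.v *)
From HB Require Import structures.
From mathcomp Require Import all_boot all_order all_algebra.
From mathcomp Require Import complex.
From mathcomp Require Import all_classical reals topology normedtype.

Set Implicit Arguments.
Unset Strict Implicit.
Unset Printing Implicit Defensive.

Import Order.TTheory GRing.Theory Num.Theory.
Import numFieldNormedType.Exports.

Local Open Scope classical_set_scope.
Local Open Scope ring_scope.

Variant scalar_kind := RealScalars | ComplexScalars.

Definition scalars (R : realType) (k : scalar_kind) : numFieldType :=
  match k with
  | RealScalars => R : numFieldType
  | ComplexScalars => R[i] : numFieldType
  end.

Section scalars.
Variable R : realType.

Definition ofR (k : scalar_kind) : R -> scalars R k :=
  match k with
  | RealScalars => fun x => x
  | ComplexScalars => fun x => x%:C%C
  end.

Definition re (k : scalar_kind) : scalars R k -> R :=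
  match k with
  | RealScalars => fun x => x
  | ComplexScalars => fun z => complex.Re z
  end.

Variable k : scalar_kind.
Implicit Types (a b : R) (x y : scalars R k).

Lemma ofRK : cancel (@ofR k) (@re k). Proof. by case: k. Qed.

Lemma re_normK x : ofR k (re `|x|) = `|x|.
Proof. by case: k x. Qed.

Lemma ofRD a b : ofR k (a + b) = ofR k a + ofR k b.
Proof. by case: k => //=; rewrite rmorphD. Qed.

Lemma ofRM a b : ofR k (a * b) = ofR k a * ofR k b.
Proof. by case: k => //=; rewrite rmorphM. Qed.

Lemma ofR_le a b : (ofR k a <= ofR k b) = (a <= b).
Proof. by case: k => //=; rewrite lecR. Qed.

Lemma ofR0 : ofR k 0 = 0. Proof. by case: k. Qed.
Lemma ofR1 : ofR k 1 = 1. Proof. by case: k. Qed.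

End scalars.
Arguments ofR {R k}.
Arguments re {R k}.

Section dual_space.
Variables (R : realType) (k : scalar_kind) (X : normedModType (scalars R k)).

Definition bounded_functional : {pred X -> (scalars R k)^o} :=
  fun f => `[< linear f /\ continuous f >].

Record dual := Dual {
  dual_fun :> X -> (scalars R k)^o ;
  dual_funP : dual_fun \in bounded_functional }.

HB.instance Definition _ := [isSub for dual_fun].
HB.instance Definition _ := [Choice of dual by <:].

Lemma bounded_functional_submod : submod_closed bounded_functional.
Proof.
split => [|a f g].
  rewrite unfold_in; apply/asboolP; split=> [c x y|x]; last exact: cst_continuous.
  by rewrite /= scaler0 addr0.
rewrite !unfold_in => /asboolP[lf cf] /asboolP[lg cg].
apply/asboolP; split=> [c x y|x].
  change (a *: f (c *: x + y) + g (c *: x + y) =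
    c *: (a *: f x + g x) + (a *: f y + g y)).
  by rewrite lf lg !scalerDr !scalerA [a * c]mulrC addrACA.
change ((fun x => a *: f x + g x) @ x --> a *: f x + g x).
by apply: cvgD; [apply: cvgZl_tmp; exact: cf|exact: cg].
Qed.

HB.instance Definition _ := GRing.isSubmodClosed.Build (scalars R k)
  (X -> (scalars R k)^o) bounded_functional bounded_functional_submod.

HB.instance Definition _ := [SubChoice_isSubLmodule of dual by <:].

Lemma dual_linear (f : dual) : linear f.
Proof. by case: f => f /= /asboolP[]. Qed.

HB.instance Definition _ (f : dual) :=
  GRing.isLinear.Build (scalars R k) X (scalars R k)^o _ f (dual_linear f).

Lemma dual_continuous (f : dual) : continuous f.
Proof. by case: f => f /= /asboolP[]. Qed.

Lemma dualDE (f g : dual) x : (f + g) x = f x + g x. Proof. by []. Qed.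
Lemma dualZE a (f : dual) x : (a *: f) x = a *: f x. Proof. by []. Qed.
Lemma dual_eqP (f g : dual) : f =1 g -> f = g.
Proof. by move=> fg; apply: val_inj; apply/funext. Qed.

(* The norm of the library takes its values in the scalar field, hence the use
   of [re] to return to R. *)
Definition opnorm (f : dual) : R :=
  sup [set re `|f x| | x in [set x : X | `|x| <= 1]].

Lemma opnorm_has_sup (f : dual) :
  has_sup [set re `|f x| | x in [set x : X | `|x| <= 1]].
Proof.
split; first by exists (re `|f 0|), 0; rewrite //= normr0.
have /linear_bounded_continuous/linear_boundedP :
  continuous (f : {linear X -> (scalars R k)^o}) by exact: dual_continuous.
move=> /pinfty_ex_gt0[M M0 fM]; exists (re `|M|) => _ [x /= x1 <-].
rewrite -(@ofR_le R k) !re_normK (gtr0_norm M0); apply: le_trans (fM x) _.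
by rewrite ler_piMr// ltW.
Qed.

Lemma opnorm_ub (f : dual) x : `|x| <= 1 -> `|f x| <= ofR (opnorm f).
Proof.
move=> x1; rewrite -re_normK ofR_le; apply: sup_ubound; last by exists x.
by have [] := opnorm_has_sup f.
Qed.

Lemma opnorm_le (f : dual) (M : R) :
  (forall x, `|x| <= 1 -> `|f x| <= ofR M) -> opnorm f <= M.
Proof.
move=> fM; apply: ge_sup; first by have [] := opnorm_has_sup f.
by move=> _ [x /= x1 <-]; rewrite -(@ofR_le R k) re_normK fM.
Qed.

Definition dual_norm (f : dual) : scalars R k := ofR (opnorm f).

Lemma dual_norm_ge0 f : 0 <= dual_norm f.
Proof. by rewrite (le_trans (normr_ge0 (f 0)))// opnorm_ub// normr0. Qed.

Lemma dual_normD f g : dual_norm (f + g) <= dual_norm f + dual_norm g.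
Proof.
rewrite /dual_norm -ofRD ofR_le; apply: opnorm_le => x x1.
by rewrite dualDE (le_trans (ler_normD _ _))// ofRD lerD// opnorm_ub.
Qed.

Lemma dual_norm_leZ a f : dual_norm (a *: f) <= `|a| * dual_norm f.
Proof.
rewrite /dual_norm -re_normK -ofRM ofR_le; apply: opnorm_le => x x1.
by rewrite dualZE normrZ ofRM re_normK ler_wpM2l// opnorm_ub.
Qed.

Lemma dual_normZ a f : dual_norm (a *: f) = `|a| * dual_norm f.
Proof.
apply/eqP; rewrite eq_le dual_norm_leZ/=.
have [->|a0] := eqVneq a 0; first by rewrite normr0 mul0r dual_norm_ge0.
rewrite -[in X in X <= _](scalerK a0 f) -ler_pdivlMl ?normr_gt0//.
by rewrite -normfV dual_norm_leZ.
Qed.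

Lemma dual_norm_eq0 f : dual_norm f = 0 -> f = 0.
Proof.
move=> f0; apply: dual_eqP => x; apply/eqP; rewrite -normr_le0.
have [->|x0] := eqVneq x 0; first by rewrite linear0 normr0.
have nx0 : `|x| != 0 by rewrite normr_eq0.
rewrite -(scalerK nx0 x) scalerA mulrC -scalerA linearZ normrZ.
rewrite (_ : `|f _| = 0) ?mulr0//; apply/eqP; rewrite -normr_le0 normr_id -f0.
by apply: opnorm_ub; rewrite normrZ normfV normr_id mulVf.
Qed.

HB.instance Definition _ := Lmodule_isNormed.Build (scalars R k) dual
  dual_normD dual_normZ dual_norm_eq0.

Lemma dual_normE (f : dual) : `|f| = ofR (opnorm f). Proof. by []. Qed.

End dual_space.

Section bishop_phelps_bollobas.
Variables (R : realType) (k : scalar_kind) (X : normedModType (scalars R k)).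
Implicit Types (D : set (X * dual X)) (delta e : R).

Definition duality_pairs : set (X * dual X) :=
  [set p : X * dual X | [/\ `|p.1| = 1, `|p.2| = 1 & p.2 p.1 = 1]].

Definition ball_pairs : set (X * dual X) :=
  [set p : X * dual X | `|p.1| <= 1 /\ `|p.2| <= 1].

Definition sphere_pairs : set (X * dual X) :=
  [set p : X * dual X | `|p.1| = 1 /\ `|p.2| = 1].

Definition bpb_approximable D delta e : Prop :=
  forall (x : X) (f : dual X), D (x, f) -> re (f x) > 1 - delta ->
  exists (y : X) (g : dual X),
    [/\ duality_pairs (y, g), `|x - y| < ofR e & `|f - g| < ofR e].

(* For X != 0, every e > 2 belongs to the set, so that [inf] is the infimum. *)
Definition bpb_modulus_on D delta : R :=
  inf [set e | 0 < e /\ bpb_approximable D delta e].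

Definition bpb_modulus delta : R := bpb_modulus_on ball_pairs delta.

Definition spherical_bpb_modulus delta : R :=
  bpb_modulus_on sphere_pairs delta.

End bishop_phelps_bollobas.

(* Main.v *)
(* Write X' for the dual of X and J for the embedding of X into X''. Given (x, f)
   in the ball (or sphere) of X and X', the hypothesis on X' applied to (f, J x)
   gives a duality pair (g, G) of X' with g near f and G near J x. A Hahn-Banach
   argument in X * X * K replaces G by a point y of X, almost in the unit ball and
   almost as near to x, with Re (g y) close to 1; the Bishop-Phelps argument then
   moves (y, g) to a duality pair of X by an arbitrarily small perturbation.
   Since the inequality |G - J x| < e is strict, the same e works for X. *)

Require Import Defs.
From HB Require Import structures.
From mathcomp Require Import all_boot all_order all_algebra.
From mathcomp Require Import complex lra.
From mathcomp Require Import all_classical reals topology normedtype.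

Set Implicit Arguments.
Unset Strict Implicit.
Unset Printing Implicit Defensive.

Import Order.TTheory GRing.Theory Num.Theory.
Import numFieldNormedType.Exports.

Local Open Scope classical_set_scope.
Local Open Scope ring_scope.

(** * Real parts of scalars, for both fields at once *)

Section scalar_theory.
Variables (R : realType) (k : scalar_kind).
Implicit Types (a : R) (z w : scalars R k).

Lemma re_additive : {morph (@re R k) : z w / z + w}.
Proof. by case: k => // -[a b] [c d]. Qed.

Lemma re0 : re (0 : scalars R k) = 0. Proof. by case: k. Qed.

Lemma reN z : re (- z) = - re z.
Proof. by apply/eqP; rewrite -addr_eq0 -re_additive addNr re0. Qed.

Lemma reB z w : re (z - w) = re z - re w.
Proof. by rewrite re_additive reN. Qed.

Lemma re_ofRM a z : re (ofR a * z) = a * re z.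
Proof. by case: k z => //= -[c d] /=; rewrite mul0r subr0. Qed.

Lemma ofRN a : ofR (- a) = - ofR a :> scalars R k.
Proof. by apply/eqP; rewrite -addr_eq0 -ofRD addNr ofR0. Qed.

Lemma ofR_lt a b : (@ofR R k a < ofR b) = (a < b).
Proof. by rewrite !lt_neqAle ofR_le (can_eq (@ofRK R k)). Qed.

Lemma norm_scalarC (z : R[i]) :
  `|z : scalars R ComplexScalars| =
  (Num.sqrt (complex.Re z ^+ 2 + complex.Im z ^+ 2))%:C%C.
Proof. exact: normc_def. Qed.

Lemma norm_ofR a : `|ofR a : scalars R k| = ofR `|a|.
Proof.
by case: k => //=; rewrite [LHS]norm_scalarC/= expr0n/= addr0 sqrtr_sqr.
Qed.

Lemma re_ge0 z : 0 <= z -> 0 <= re z.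
Proof. by move=> z0; rewrite -(ger0_norm z0) -(@ofR_le _ k) re_normK ofR0. Qed.

Lemma ofR_re z : 0 <= z -> ofR (re z) = z.
Proof. by move=> z0; rewrite -(ger0_norm z0) re_normK. Qed.

Lemma re_mono z w : z <= w -> re z <= re w.
Proof. by move=> zw; rewrite -subr_ge0 -reB re_ge0// subr_ge0. Qed.

Lemma re_le_norm z : re z <= re `|z|.
Proof.
case: k z => [z|[a b]]; first exact: ler_norm.
rewrite [`|_|]norm_scalarC /=; apply: le_trans (ler_norm _) _.
by rewrite -sqrtr_sqr ler_wsqrtr// lerDl sqr_ge0.
Qed.

(** Squaring the hypothesis leaves no room for an imaginary part. This upgrades equalities of real
    parts to equalities of scalars. *)
Lemma re_norm_eq z : re `|z| <= re z -> z = ofR (re z).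
Proof.
case: k z => [z|[a b]] //; rewrite [`|_|]norm_scalarC /= => h.
have a0 : 0 <= a by exact: le_trans (sqrtr_ge0 _) h.
have : Num.sqrt (a ^+ 2 + b ^+ 2) ^+ 2 <= a ^+ 2 by rewrite ler_sqr ?nnegrE ?sqrtr_ge0.
rewrite sqr_sqrtr ?addr_ge0 ?sqr_ge0// gerDl => b0.
have /eqP : b ^+ 2 == 0 by rewrite eq_le b0 sqr_ge0.
by move/eqP; rewrite sqrf_eq0 => /eqP ->.
Qed.

(** Rotating a vector by such a unit scalar makes the value of a functional there equal to its
    modulus, so bounds on real parts control moduli. *)
Lemma phaseP z : exists2 w : scalars R k, `|w| = 1 & w * z = `|z|.
Proof.
have [->|z0] := eqVneq z 0; first by exists 1; rewrite ?normr1// mulr0 normr0.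
exists (`|z| / z); first by rewrite normrM normfV normr_id mulfV// normr_eq0.
by rewrite divfK.
Qed.

(* A complex-linear functional is recovered from its real part h as
   x |-> h x - i h (i x). *)
Lemma complexification (V : lmodType (scalars R k)) (h : V -> R) :
  {morph h : x y / x + y} -> (forall t x, h (ofR t *: x) = t * h x) ->
  exists2 f : V -> (scalars R k)^o, linear f & forall x, re (f x) = h x.
Proof.
case: k V h => V h hD hZ; first by exists h => // a x y; rewrite hD hZ.
pose I : scalars R ComplexScalars := 'i%C.
exists (fun x => (h x +i* - h (I *: x))%C) => // a x y.
have aE u : a *: u = (ofR (complex.Re a) : scalars R ComplexScalars) *: u +
    (ofR (complex.Im a) : scalars R ComplexScalars) *: (I *: u).
  rewrite scalerA -scalerDl; congr (_ *: _).
  by case: a => a b; rewrite /I /=; simpc.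
have hN u : h (- u) = - h u.
  by apply/eqP; rewrite -addr_eq0 -hD addNr -(scale0r 0) (hZ 0) mul0r.
have IIN u : I *: (I *: u) = - u.
  by rewrite scalerA (_ : I * I = -1) ?scaleN1r//; exact: sqr_i.
have IaC u : I *: (a *: u) = a *: (I *: u) by rewrite !scalerA mulrC.
rewrite !scalerDr IaC !hD !aE !hD !hZ IIN hN.
case: a {aE IaC} => a b /=; apply/eqP; rewrite eq_complex /=.
by apply/andP; split; apply/eqP; lra.
Qed.

End scalar_theory.

(** * Sublinear functionals, Hahn-Banach and Mazur-Orlicz *)

Section hahn_banach.
Variables (R : realType) (k : scalar_kind) (V : lmodType (scalars R k)).
Implicit Types (p q : V -> R) (C : set (V * R)).

Definition sublinear p :=
  (forall x y, p (x + y) <= p x + p y) /\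
  (forall t x, 0 <= t -> p (ofR t *: x) <= t * p x).

Definition real_linear (h : V -> R) :=
  {morph h : x y / x + y} /\ forall t x, h (ofR t *: x) = t * h x.

Lemma sublinear0 p : sublinear p -> p 0 = 0.
Proof.
move=> [pD pZ]; apply/eqP; rewrite eq_le -{1}(scale0r 0) -(@ofR0 R k).
rewrite (le_trans (pZ _ _ _))//= ?mul0r//.
by have := pD 0 0; rewrite addr0 lerDr.
Qed.

(** This lower bound depends on [p] alone, so pointwise infima of sublinear minorants of [p] are
    finite. *)
Lemma sublinear_ge p q x : sublinear q -> (forall y, q y <= p y) -> - p (- x) <= q x.
Proof.
move=> sq qp; have [qD _] := sq; have := qD x (- x).
by rewrite subrr sublinear0//; have := qp (- x); lra.
Qed.

Definition cone_over C := [/\ C (0, 0),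
  forall c d, C c -> C d -> C (c.1 + d.1, c.2 + d.2) &
  forall t c, 0 <= t -> C c -> C (ofR t *: c.1, t * c.2)].

(** For a cone [C] with [c.2 <= q c.1], a linear [h] below [shave q C] lies below [q] and, by
    evaluation at [- c.1], satisfies [c.2 <= h c.1] on [C]: one upper bound encodes both
    constraints. *)
Definition shave q C (v : V) : R := inf [set q (v + c.1) - c.2 | c in C].

Section shave.
Variables (q : V -> R) (C : set (V * R)).
Hypotheses (sq : sublinear q) (coneC : cone_over C).
Hypothesis Cq : forall c, C c -> c.2 <= q c.1.

Lemma shave_le v c : C c -> shave q C v <= q (v + c.1) - c.2.
Proof.
move=> Cc; apply: ge_inf; last by exists c.
(* Bounded below, since [q d.1 <= q (v + d.1) + q (- v)] and [d.2 <= q d.1]. *)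
exists (- q (- v)) => _ [d /= Cd <-].
have [qD _] := sq; have := qD (v + d.1) (- v).
by rewrite addrAC subrr add0r; have := Cq Cd; lra.
Qed.

Lemma le_shave v M : (forall c, C c -> M <= q (v + c.1) - c.2) -> M <= shave q C v.
Proof.
have [C0 _ _] := coneC.
move=> h; apply: lb_le_inf => [|_ [c /= Cc <-]]; last exact: h.
by exists (q (v + 0) - 0), (0, 0).
Qed.

Lemma shave_leq v : shave q C v <= q v.
Proof.
by have [C0 _ _] := coneC; have := shave_le v C0; rewrite /= addr0 subr0.
Qed.

Lemma shave_opp c : C c -> shave q C (- c.1) <= - c.2.
Proof.
by move=> Cc; have := shave_le (- c.1) Cc; rewrite addNr sublinear0// add0r.
Qed.

(** Sums of members of the cone serve [x + y], and their dilates serve [ofR t *: x]. *)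
Lemma shave_sublinear : sublinear (shave q C).
Proof.
have [qD qZ] := sq; have [C0 CD CZ] := coneC.
split=> [x y|t x t0].
  rewrite -lerBlDr; apply: le_shave => c Cc; rewrite lerBlDr -lerBlDl.
  apply: le_shave => d Cd; have := shave_le (x + y) (CD _ _ Cc Cd).
  by rewrite /= addrACA; have := qD (x + c.1) (y + d.1); lra.
have [->|tn0] := eqVneq t 0.
  by rewrite ofR0 scale0r mul0r -(sublinear0 sq) shave_leq.
have tp : 0 < t by rewrite lt_def tn0.
rewrite -ler_pdivrMl//; apply: le_shave => c Cc.
rewrite ler_pdivrMl// mulrBr; have := shave_le (ofR t *: x) (CZ _ _ t0 Cc).
by rewrite /= -scalerDr; have := qZ t (x + c.1) t0; lra.
Qed.

End shave.

Definition ray x (r : R) : set (V * R) :=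
  [set c | exists2 t : R, 0 <= t & c = (ofR t *: x, t * r)].

Lemma cone_ray x r : cone_over (ray x r).
Proof.
split; first by exists 0; rewrite // ofR0 scale0r mul0r.
  move=> _ _ [t t0 ->] [s s0 ->]; exists (t + s); first exact: addr_ge0.
  by rewrite /= ofRD scalerDl mulrDl.
move=> t _ t0 [s s0 ->]; exists (t * s); first exact: mulr_ge0.
by rewrite /= scalerA ofRM mulrA.
Qed.

(** Zorn's lemma for the reversed pointwise order: a nonempty chain is bounded by its pointwise
    infimum [m], the empty one by [p]. *)
Lemma minimal_sublinear p : sublinear p -> exists q, [/\ sublinear q,
  forall x, q x <= p x &
  forall q', sublinear q' -> (forall x, q' x <= q x) -> q' = q].
Proof.
move=> sp.
pose T := {q : V -> R | sublinear q /\ forall x, q x <= p x}.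
pose r : rel T := fun a b => `[< forall x, sval b x <= sval a x >].
have [||||q qmin] := @Zorn T r.
- by move=> a; apply/asboolP.
- move=> a b c /asboolP ab /asboolP bc; apply/asboolP => x.
  exact: le_trans (bc x) (ab x).
- move=> a b /asboolP ab /asboolP ba.
  apply: eq_sig_hprop => [? ? ?|]; first exact: Prop_irrelevance.
  apply/funext => x.
  by apply/eqP; rewrite eq_le ab ba.
- move=> A totA; have [[a Aa]|A0] := pselect (exists a, A a); last first.
    exists (exist _ p (conj sp (fun x => lexx (p x)))) => s As.
    by exfalso; apply: A0; exists s.
  pose m x := inf [set sval b x | b in A].
  have mle b x : A b -> m x <= sval b x.
    move=> Ab; apply: ge_inf; last by exists b.
    exists (- p (- x)) => _ [c _ <-].
    by have [sc cp] := svalP c; exact: sublinear_ge.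
  have lem x M : (forall b, A b -> M <= sval b x) -> M <= m x.
    move=> h; apply: lb_le_inf => [|_ [c /= Ac <-]]; last exact: h.
    by exists (sval a x), a.
  have sm : sublinear m.
    split=> [x y|t x t0].
      rewrite -lerBlDr; apply: (lem) => b Ab; rewrite lerBlDr -lerBlDl.
      apply: (lem) => c Ac; rewrite lerBlDl.
      (* The lower of [b] and [c] bounds [m (x + y)] by its own subadditivity; replacing it by the
         other in one term only increases the sum. *)
      have [bc|cb] := totA b c Ab Ac.
        have [[cD _] _] := svalP c; apply: le_trans (mle c _ Ac) _.
        by apply: le_trans (cD _ _) _; rewrite lerD2r; move/asboolP: bc.
      have [[bD _] _] := svalP b; apply: le_trans (mle b _ Ab) _.
      by apply: le_trans (bD _ _) _; rewrite lerD2l; move/asboolP: cb.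
    have [->|tn0] := eqVneq t 0.
      rewrite ofR0 scale0r mul0r; have [sa _] := svalP a.
      by rewrite -(sublinear0 sa) mle.
    have tp : 0 < t by rewrite lt_def tn0.
    rewrite -ler_pdivrMl//; apply: (lem) => b Ab; rewrite ler_pdivrMl//.
    by have [[_ bZ] _] := svalP b; apply: le_trans (mle b _ Ab) (bZ _ _ t0).
  have mp x : m x <= p x by have [_ ap] := svalP a; exact: le_trans (mle a x Aa) _.
  by exists (exist _ m (conj sm mp)) => s As; apply/asboolP => x; exact: mle.
case: q qmin => q [sq qp] qmin; exists q; split => // q' sq' q'q.
have q'p x : q' x <= p x by exact: le_trans (q'q x) (qp x).
pose q'T : T := exist _ q' (conj sq' q'p).
by have := qmin q'T; rewrite /r/= => /(_ (asboolT q'q)) /(congr1 sval).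
Qed.

(* A minimal sublinear functional cannot be lowered along any ray, which makes
   it odd, hence linear. *)
Lemma hahn_banach p : sublinear p ->
  exists2 h, real_linear h & forall x, h x <= p x.
Proof.
move=> /minimal_sublinear[q [sq qp qmin]]; exists q => //.
have qN x : q (- x) = - q x.
  (* Shaving [q] along the ray through [(x, q x)] gives back [q] by minimality, so [shave_opp] reads
     [q (- x) <= - q x]. *)
  have rayq c : ray x (q x) c -> c.2 <= q c.1.
    move=> [t t0 ->] /=; have [->|tn0] := eqVneq t 0.
      by rewrite ofR0 scale0r mul0r sublinear0.
    have tp : 0 < t by rewrite lt_def tn0.
    have [_ qZ] := sq; rewrite -ler_pdivlMl//.
    rewrite -[x in q x <= _](scale1r x) -(@ofR1 R k) -(mulVf tn0) ofRM -scalerA.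
    by apply: qZ; rewrite invr_ge0.
  have sE := qmin _ (shave_sublinear sq (cone_ray x (q x)) rayq)
    (shave_leq sq (cone_ray x (q x)) rayq).
  have := sublinear_ge x sq (fun y => lexx (q y)).
  have : ray x (q x) (x, q x) by exists 1; rewrite // ofR1 scale1r mul1r.
  by move=> /(shave_opp sq rayq); rewrite sE /=; lra.
have [qD qZ] := sq; split=> [x y|].
  by have := qD x y; have := qD (- x) (- y); rewrite -opprD !qN; lra.
have qZ0 t x : 0 <= t -> q (ofR t *: x) = t * q x.
  move=> t0; have := qZ t x t0; have := qZ t (- x) t0.
  by rewrite scalerN !qN; lra.
move=> t x; have [t0|t0] := leP 0 t; first exact: qZ0.
by rewrite -{1}(opprK t) ofRN scaleNr qN qZ0 ?oppr_ge0 ?ltW// mulNr opprK.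
Qed.

(* Mazur-Orlicz: Hahn-Banach applied to the shaved functional. *)
Lemma mazur_orlicz q C : sublinear q -> cone_over C ->
    (forall c, C c -> c.2 <= q c.1) ->
  exists h, [/\ real_linear h, forall x, h x <= q x & forall c, C c -> c.2 <= h c.1].
Proof.
move=> sq coneC Cq; have [h [hD hZ] hp] := hahn_banach (shave_sublinear sq coneC Cq).
exists h; split => // [x|c Cc]; first exact: le_trans (hp x) (shave_leq sq coneC Cq x).
have := hp (- c.1); have := shave_opp sq Cq Cc; have := hD c.1 (- c.1).
have h0 : h 0 = 0 by rewrite -(scale0r 0) -(@ofR0 R k) hZ mul0r.
by rewrite subrr h0; lra.
Qed.

End hahn_banach.

(** * Real-valued norms and real parts of functionals *)

Section real_norm.
Variables (R : realType) (k : scalar_kind).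

(** Norms take values in the scalar field; this copy in [R] brings estimates within reach of
    [lra]. *)
Definition rnorm (V : normedModType (scalars R k)) (x : V) : R := re `|x|.

Section theory.
Variable V : normedModType (scalars R k).
Implicit Types x y : V.

Lemma ofR_rnorm x : ofR (rnorm x) = `|x|. Proof. exact: ofR_re. Qed.

Lemma rnorm_ge0 x : 0 <= rnorm x. Proof. exact: re_ge0. Qed.

Lemma rnormD x y : rnorm (x + y) <= rnorm x + rnorm y.
Proof. by rewrite -re_additive re_mono// ler_normD. Qed.

Lemma rnormN x : rnorm (- x) = rnorm x. Proof. by rewrite /rnorm normrN. Qed.

Lemma rnormB x y : rnorm (x - y) = rnorm (y - x).
Proof. by rewrite -rnormN opprB. Qed.

Lemma rnorm0 : rnorm (0 : V) = 0. Proof. by rewrite /rnorm normr0 re0. Qed.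

Lemma rnormZ t x : rnorm (ofR t *: x) = `|t| * rnorm x.
Proof. by rewrite /rnorm normrZ norm_ofR re_ofRM. Qed.

Lemma rnorm_eq0 x : rnorm x = 0 -> x = 0.
Proof. by move=> x0; apply/eqP; rewrite -normr_eq0 -ofR_rnorm x0 ofR0. Qed.

Lemma sublinear_rnorm (l : R) : 0 <= l -> sublinear (fun x : V => l * rnorm x).
Proof.
move=> l0; split=> [x y|t x t0]; first by rewrite -mulrDr ler_wpM2l// rnormD.
by rewrite rnormZ ger0_norm// mulrCA.
Qed.

Lemma norm_le_ofR x (r : R) : (`|x| <= ofR r) = (rnorm x <= r).
Proof. by rewrite -ofR_rnorm ofR_le. Qed.

Lemma norm_lt_ofR x (r : R) : (`|x| < ofR r) = (rnorm x < r).
Proof. by rewrite -ofR_rnorm ofR_lt. Qed.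

Lemma norm_eq_ofR x (r : R) : rnorm x = r -> `|x| = ofR r.
Proof. by rewrite -ofR_rnorm => ->. Qed.

End theory.

Section functionals.
Variable X : normedModType (scalars R k).
Implicit Types (f g : dual X) (x : X).

Lemma rnorm_dual f : rnorm f = opnorm f. Proof. exact: ofRK. Qed.

Lemma re_dual0 f : re (f 0) = 0. Proof. by rewrite linear0 re0. Qed.

Lemma re_dualD f x y : re (f (x + y)) = re (f x) + re (f y).
Proof. by rewrite linearD re_additive. Qed.

Lemma re_dualN f x : re (f (- x)) = - re (f x).
Proof. by rewrite linearN reN. Qed.

Lemma re_dualB f x y : re (f (x - y)) = re (f x) - re (f y).
Proof. by rewrite re_dualD re_dualN. Qed.

Lemma re_dualZ f t x : re (f (ofR t *: x)) = t * re (f x).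
Proof. by rewrite linearZ re_ofRM. Qed.

Lemma re_dual_le f x : re (f x) <= rnorm f * rnorm x.
Proof.
have [->|x0] := eqVneq x 0; first by rewrite linear0 re0 rnorm0 mulr0.
have nx0 : rnorm x != 0 by apply: contra_neq x0; exact: rnorm_eq0.
have nx : 0 < rnorm x by rewrite lt_def nx0 rnorm_ge0.
rewrite -ler_pdivrMr// mulrC -re_dualZ (le_trans (re_le_norm _))// rnorm_dual.
rewrite -(@ofR_le R k) re_normK opnorm_ub// -(@ofR1 R k) norm_le_ofR rnormZ.
by rewrite gtr0_norm ?invr_gt0// mulVf.
Qed.

(** The phase of [f x] can be absorbed into [x] without leaving the unit ball. *)
Lemma rnorm_dual_le f (M : R) :
  (forall x, rnorm x <= 1 -> re (f x) <= M) -> rnorm f <= M.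
Proof.
move=> fM; rewrite rnorm_dual; apply: opnorm_le => x x1.
have [w w1 wf] := phaseP (f x).
have wx1 : rnorm (w *: x) <= 1.
  by rewrite /rnorm normrZ w1 mul1r -norm_le_ofR ofR1.
by rewrite -re_normK ofR_le -wf -[w * f x]/(w *: f x) -linearZ fM.
Qed.

Lemma dual_re_eq f g : (forall x, re (f x) = re (g x)) -> f = g.
Proof.
move=> fg; apply/eqP; rewrite -subr_eq0; apply/eqP/rnorm_eq0/eqP.
rewrite eq_le rnorm_ge0 andbT; apply: rnorm_dual_le => x _.
by rewrite (_ : (f - g) x = f x - g x)// reB fg subrr.
Qed.

(** Absorbing the phase of [f x] into [x] turns the one-sided bound on real parts into a bound on
    the modulus, hence continuity. *)
Lemma dual_of_bounded (f : X -> (scalars R k)^o) (M : R) : linear f ->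
  (forall x, re (f x) <= M * rnorm x) -> exists g : dual X, forall x, g x = f x.
Proof.
move=> lf fM; pose lfT := GRing.isLinear.Build _ _ _ _ f lf.
pose fl : {linear X -> (scalars R k)^o} := HB.pack f lfT.
suff cf : f \in @bounded_functional R k X by exists (Dual cf).
apply/asboolP; split => //.
apply: (@linear_bounded_continuous _ _ _ fl).1; apply/linear_boundedP.
exists (ofR M); split; first by rewrite realE -!(@ofR0 R k) !ofR_le le_total.
move=> r Mr x; have [w w1 wf] := phaseP (f x).
have fw : f (w *: x) = `|f x| by rewrite -wf; exact: (linearZ_LR fl w x).
change (`|f x| <= r * `|x|); rewrite -fw.
have -> : f (w *: x) = ofR (re (f (w *: x))).
  by apply: re_norm_eq; rewrite fw normr_id.
apply: le_trans (_ : ofR (M * rnorm (w *: x)) <= _); first by rewrite ofR_le.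
by rewrite ofRM ofR_rnorm normrZ w1 mul1r ler_wpM2r// ltW.
Qed.

End functionals.
End real_norm.

(** * Duality pairs, norming functionals and evaluation in the bidual *)

Section duality.
Variables (R : realType) (k : scalar_kind).

Section one_space.
Variable X : normedModType (scalars R k).
Implicit Types (f g : dual X) (x : X).

Lemma norm_dual_le f x : re `|f x| <= rnorm f * rnorm x.
Proof.
have [w w1 <-] := phaseP (f x).
rewrite -[w * f x]/(w *: f x) -linearZ (le_trans (re_dual_le _ _))//.
by rewrite /rnorm normrZ w1 mul1r.
Qed.

(** The modulus of [f x] is at most 1, which is its real part, so [f x] is real. *)
Lemma duality_pairs_re x f :
  rnorm x = 1 -> rnorm f = 1 -> re (f x) = 1 -> @duality_pairs R k X (x, f).
Proof.
move=> x1 f1 fx1; split => /=; rewrite -?(@ofR1 R k); [exact: norm_eq_ofR..|].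
rewrite -fx1; apply: re_norm_eq.
by rewrite fx1 (le_trans (norm_dual_le _ _))// x1 f1 mulr1.
Qed.

Lemma dual_of_real_linear (h : X -> R) (M : R) : real_linear h ->
  (forall x, h x <= M * rnorm x) -> exists f : dual X, forall x, re (f x) = h x.
Proof.
move=> [hD hZ] hM; have [f lf fh] := complexification hD hZ.
have [|g gf] := @dual_of_bounded _ _ _ f M lf; first by move=> x; rewrite fh.
by exists g => x; rewrite gf.
Qed.

(** Domination by the norm gives [rnorm f <= 1], while the ray through [(x, rnorm x)] forces the
    value at [x] up to [rnorm x]. *)
Lemma norming_functional x : exists2 f : dual X, rnorm f <= 1 & re (f x) = rnorm x.
Proof.
have raynorm c : ray x (rnorm x) c -> c.2 <= 1 * rnorm c.1.
  by move=> [t t0 ->]; rewrite /= rnormZ ger0_norm// mul1r.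
have [h [lh h1 hx]] :=
  mazur_orlicz (sublinear_rnorm X ler01) (cone_ray x (rnorm x)) raynorm.
have [f fh] := dual_of_real_linear lh h1.
have f1 : rnorm f <= 1.
  apply: rnorm_dual_le => y y1; rewrite fh (le_trans (h1 y))//.
  by rewrite mul1r.
exists f => //; apply/eqP; rewrite eq_le; apply/andP; split.
  by rewrite (le_trans (re_dual_le _ _))// ler_piMl// rnorm_ge0.
rewrite fh; have := hx (x, rnorm x); apply.
by exists 1; rewrite // ofR1 scale1r mul1r.
Qed.

Lemma unit_norming_functional x : x != 0 ->
  exists2 f : dual X, rnorm f = 1 & re (f x) = rnorm x.
Proof.
move=> x0; have [f f1 fx] := norming_functional x; exists f => //.
have xp : 0 < rnorm x.
  by rewrite lt_def rnorm_ge0 andbT; apply: contra_neq x0; exact: rnorm_eq0.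
apply/eqP; rewrite eq_le f1 -(ler_pM2r xp) mul1r -fx /=.
by rewrite {2}fx re_dual_le.
Qed.

Lemma dual_evaluation x : exists F : dual (dual X),
  (forall f, F f = f x) /\ rnorm F = rnorm x.
Proof.
have [|f|F FE] := @dual_of_bounded R k (dual X) (fun f => f x) (rnorm x).
- by move=> a f g.
- by rewrite mulrC re_dual_le.
exists F; split => //; apply/eqP; rewrite eq_le; apply/andP; split.
  apply: rnorm_dual_le => f f1; rewrite FE (le_trans (re_dual_le _ _))//.
  by rewrite ler_piMl// rnorm_ge0.
have [f f1 fx] := norming_functional x; rewrite -fx -FE.
by rewrite (le_trans (re_dual_le _ _))// ler_piMr// rnorm_ge0.
Qed.

End one_space.

(** * Replacing a point of the bidual by a point of the space *)

Section almost_reflexivity.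
Variable X : normedModType (scalars R k).

(* Only the part of the principle of local reflexivity that moves one point
   of X** into X: the wanted y puts (y, y - x, f y) close to (0, x, 1) in
   X * X * K, and this distance is computed by duality. *)
Lemma almost_reflexive (F : dual (dual X)) (f : dual X) (x : X) (r s : R) :
    0 < r -> 0 < s -> rnorm F <= 1 -> F f = 1 ->
    (forall g, re (F g) - re (g x) <= r * rnorm g) ->
  exists y, [/\ rnorm y < 1 + s, rnorm (y - x) < r * (1 + s) &
    re (f y) > 1 - s * (1 + s)].
Proof.
move=> r0 s0 F1 Ff Fx.
pose K : normedModType (scalars R k) := (scalars R k)^o.
pose V : lmodType (scalars R k) := (X * X * K)%type.
(* The weights make [q (v y 1) < 1 + s], with [v] as below, imply all three bounds wanted for
   [y]. *)
pose q (v : V) : R :=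
  Num.max (rnorm v.1.1) (Num.max (r^-1 * rnorm v.1.2) (s^-1 * rnorm v.2)).
have r'0 : 0 < r^-1 by rewrite invr_gt0.
have s'0 : 0 < s^-1 by rewrite invr_gt0.
have sq : sublinear q.
  split=> [a b|t a t0]; rewrite /q /=.
    rewrite !ge_max; apply/and3P; split.
    - by rewrite (le_trans (rnormD _ _))// lerD// !le_max lexx.
    - rewrite (le_trans ((sublinear_rnorm X (ltW r'0)).1 _ _))//.
      by rewrite lerD// !le_max lexx ?orbT.
    - rewrite (le_trans ((sublinear_rnorm K (ltW s'0)).1 _ _))//.
      by rewrite lerD// !le_max lexx ?orbT.
  rewrite !rnormZ ger0_norm// !(mulrCA _ t) -!maxr_pMr//.
have q0 v : 0 <= q v by rewrite /q le_max rnorm_ge0.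
pose v y t : V := (y, y - ofR t *: x, f y - ofR t).
apply: contrapT => noy.
have dist y : 1 + s <= q (v y 1).
  rewrite leNgt; apply/negP; rewrite /q !gt_max => /and3P[y1 yx yf]; apply: noy.
  exists y; split => //.
    by move: yx; rewrite ltr_pdivrMl// /v/= ofR1 scale1r.
  move: yf; rewrite ltr_pdivrMl// /v/= => yf.
  have := re_le_norm (ofR 1 - f y); rewrite reB ofRK distrC => /le_lt_trans.
  by move=> /(_ _ yf); lra.
(* The conic hull of the bound [dist], completed at [t = 0] by the subspace of all [(y, y, f y)],
   with value 0. *)
pose C : set (V * R) := [set c | exists y t, 0 <= t /\ c = (v y t, t * (1 + s))].
have coneC : cone_over C.
  split.
  - by exists 0, 0; rewrite /v !ofR0 scale0r !subr0 linear0 mul0r.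
  - move=> _ _ [y [t [t0 ->]]] [z [u [u0 ->]]].
    exists (y + z), (t + u); split; first exact: addr_ge0.
    rewrite /v /= ofRD scalerDl !opprD mulrDl; congr (_, _).
    by congr (_, _, _); rewrite /= addrACA ?[f (y + z)]linearD.
  - move=> u _ u0 [y [t [t0 ->]]]; exists (ofR u *: y), (u * t).
    split; first exact: mulr_ge0.
    rewrite /v /= ofRM -scalerA mulrA; congr (_, _).
    by congr (_, _, _); rewrite /= ?[f (_ *: y)]linearZ ?scalerBr ?mulrBr.
have Cq c : C c -> c.2 <= q c.1.
  move=> [y [t [t0 ->]]] /=; have [->|tn0] := eqVneq t 0; first by rewrite mul0r.
  have tp : 0 < t by rewrite lt_def tn0.
  rewrite -ler_pdivlMl// (le_trans (dist (ofR t^-1 *: y)))//.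
  have := sq.2 t^-1 (v y t); rewrite invr_ge0 => /(_ t0); congr (q _ <= _).
  have tK : ofR t^-1 * ofR t = ofR 1 :> scalars R k by rewrite -ofRM mulVf.
  rewrite /v; congr (_, _, _); rewrite /= scalerBr; first by rewrite scalerA tK.
  by rewrite [f (_ *: y)]linearZ [X in _ - X = _]tK.
have [h [[hD hZ] hq hC]] := mazur_orlicz sq coneC Cq.
have q1 a : q (a, 0, 0) = rnorm a.
  by rewrite /q /= !rnorm0 !mulr0 maxxx; apply/max_idPl/rnorm_ge0.
have q2 b : q (0, b, 0) = r^-1 * rnorm b.
  rewrite /q /= !rnorm0 !mulr0 max_r ?max_l// ?le_max;
  by rewrite mulr_ge0 ?rnorm_ge0// ltW.
have q3 c : q (0, 0, c) = s^-1 * rnorm c.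
  rewrite /q /= !rnorm0 !mulr0 max_r ?max_r// ?le_max;
  by rewrite ?lexx// mulr_ge0 ?rnorm_ge0// ltW.
have [||f1 f1E] := @dual_of_real_linear X (fun a => h (a, 0, 0)) 1.
- split=> [a b|t a]; first by rewrite -hD; congr (h (_, _, _)); rewrite /= addr0.
  by rewrite -hZ; congr (h (_, _, _)); rewrite /= scaler0.
- by move=> a; rewrite mul1r -q1.
have [||f2 f2E] := @dual_of_real_linear X (fun b => h (0, b, 0)) r^-1.
- split=> [a b|t a]; first by rewrite -hD; congr (h (_, _, _)); rewrite /= addr0.
  by rewrite -hZ; congr (h (_, _, _)); rewrite /= scaler0.
- by move=> b; rewrite -q2.
have [||f3 f3E] := @dual_of_real_linear K (fun c => h (0, 0, c)) s^-1.
- split=> [a b|t a]; first by rewrite -hD; congr (h (_, _, _)); rewrite /= addr0.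
  by rewrite -hZ; congr (h (_, _, _)); rewrite /= scaler0.
- by move=> c; rewrite -q3.
have hE a b c : h (a, b, c) = re (f1 a) + re (f2 b) + re (f3 c).
  by rewrite f1E f2E f3E -!hD; congr (h (_, _, _)); rewrite /= ?addr0 ?add0r.
(* The norm dual to a weighted maximum is a weighted sum: [h <= q] is tested at [(a, r b, 0)] with
   [a] and [b] in the unit ball, where [q] is at most 1. *)
have f12 : rnorm f1 + r * rnorm f2 <= 1.
  rewrite -lerBrDr; apply: rnorm_dual_le => a a1.
  rewrite lerBrDr -lerBrDl -ler_pdivlMl//; apply: rnorm_dual_le => b b1.
  rewrite ler_pdivlMl// lerBrDl -re_dualZ.
  have := hq (a, ofR r *: b, 0); rewrite hE linear0 re0 addr0 => /le_trans; apply.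
  rewrite /q /= rnorm0 mulr0 rnormZ gtr0_norm// mulKf ?gt_eqF//.
  by rewrite !ge_max a1 b1 ler01.
have f3M y : f3 (f y) = f3 (1 : K) * f y.
  rewrite mulrC -[f y * _]/(f y *: f3 (1 : K)) -linearZ.
  by congr (f3 _); rewrite /= [RHS]mulr1.
(* The members of [C] with [t = 0] make the real part nonnegative at both [y] and [- y]. *)
have fsum : f1 + f2 + f3 (1 : K) *: f = 0.
  have ge0 y : 0 <= re ((f1 + f2 + f3 (1 : K) *: f) y).
    rewrite (_ : _ y = f1 y + f2 y + f3 (1 : K) * f y)// !re_additive -f3M -hE.
    have := hC (v y 0, 0 * (1 + s)); rewrite /= mul0r /v ofR0 scale0r !subr0.
    by apply; exists y, 0; rewrite mul0r /v ofR0 scale0r !subr0.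
  apply: dual_re_eq => y; rewrite [RHS]re0; apply/eqP; rewrite eq_le ge0 andbT.
  by have := ge0 (- y); rewrite re_dualN oppr_ge0.
have Fsum : re (F f1) + re (F f2) + re (f3 (1 : K)) = 0.
  have : re (F (f1 + f2 + f3 (1 : K) *: f)) = 0 by rewrite fsum linear0 re0.
  by rewrite !linearD linearZ !re_additive /= Ff [_ *: _]mulr1.
(* Here [h (v 0 1)] is minus the real part of [f2 x + f3 1]. By [Fsum] it equals that of
   [F f1 + F f2 - f2 x], at most [rnorm f1 + r * rnorm f2 <= 1]: a contradiction. *)
have : 1 + s <= h (v 0 1).
  have := hC (v 0 1, 1 * (1 + s)); rewrite /= mul1r; apply.
  by exists 0, 1; rewrite mul1r.
rewrite hE linear0 re0 add0r ofR1 scale1r add0r re_dualN linear0 add0r re_dualN.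
have := Fx f2; have := re_dual_le F f1.
have : rnorm F * rnorm f1 <= rnorm f1 by rewrite ler_piMl// rnorm_ge0.
by lra.
Qed.

End almost_reflexivity.
End duality.

(** * The Bishop-Phelps-Bollobás argument, using completeness *)

Section bishop_phelps.
Variables (R : realType) (k : scalar_kind) (X : completeNormedModType (scalars R k)).
Implicit Types (f g : dual X) (x y z : X).

(** Passage to the limit in an inequality; the proof divides by [c + 1] because [c] may be 0. *)
Lemma le_of_le_addM (a b c : R) :
  0 <= c -> (forall e, 0 < e -> a <= b + c * e) -> a <= b.
Proof.
move=> c0 h; rewrite leNgt; apply/negP => ba.
have c1 : 0 < c + 1 by lra.
have e0 : 0 < (a - b) / (c + 1) by rewrite divr_gt0// subr_gt0.
have := h _ e0; rewrite mulrA => ?; suff : c * (a - b) / (c + 1) < a - b by lra.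
by rewrite ltr_pdivrMr//; nra.
Qed.

(** The point [z] is maximal above [y], within the unit ball, for the Bishop-Phelps order [le]. A
    [u] violating the last clause would lie strictly above [z]. *)
Lemma bishop_phelps_point f (l : R) y : 0 < l -> rnorm y <= 1 ->
  exists z, [/\ rnorm z <= 1, l * rnorm (z - y) <= re (f z) - re (f y) &
    forall u, rnorm u <= 1 -> re (f u) - re (f z) <= l * rnorm (u - z)].
Proof.
move=> l0 y1; pose le a b := l * rnorm (b - a) <= re (f b) - re (f a).
have le_refl a : le a a by rewrite /le !subrr rnorm0 mulr0.
have le_tr a b c : le a b -> le b c -> le a c.
  rewrite /le => ab bc.
  have := ler_wpM2l (ltW l0) (rnormD (c - b) (b - a)).
  by rewrite subrKA mulrDr; lra.
have le_asym a b : le a b -> le b a -> a = b.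
  rewrite /le rnormB => ab ba; apply/eqP; rewrite -subr_eq0; apply/eqP/rnorm_eq0.
  have := rnorm_ge0 (a - b); move: ab ba; nra.
pose T := {u : X | rnorm u <= 1 /\ le y u}.
pose r : rel T := fun a b => `[< le (sval a) (sval b) >].
have [||||z zmax] := @Zorn T r.
- by move=> a; exact/asboolP.
- by move=> a b c /asboolP ab /asboolP bc; apply/asboolP; exact: le_tr ab bc.
- move=> a b /asboolP ab /asboolP ba.
  apply: eq_sig_hprop => [? ? ?|]; first exact: Prop_irrelevance.
  exact: le_asym.
- move=> A totA; have [[a0 Aa0]|A0] := pselect (exists a, A a); last first.
    by exists (exist _ y (conj y1 (le_refl y))) => s As; exfalso; apply: A0; exists s.
  (* A chain is treated as a filter generated by its tails; its limit will be the upper bound. *)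
  pose tail (a : T) : set X :=
    [set u | exists2 b, A b & sval b = u /\ le (sval a) u].
  pose F := filter_from A tail.
  have FF : ProperFilter F.
    apply: filter_from_proper; last first.
      by move=> a Aa; exists (sval a), a.
    apply: filter_from_filter; first by exists a0.
    move=> a b Aa Ab; have [ab|ba] := totA a b Aa Ab.
      exists b => // _ [c Ac [<- bc]]; split; exists c => //; split => //.
      by apply: le_tr bc; exact/asboolP.
    exists a => // _ [c Ac [<- ac]]; split; exists c => //; split => //.
    by apply: le_tr ac; exact/asboolP.
  pose S := [set re (f (sval a)) | a in A].
  have supS : has_sup S.
    split; first by exists (re (f (sval a0))), a0.
    exists (rnorm f) => _ [a Aa <-]; have [a1 _] := svalP a.
    by rewrite (le_trans (re_dual_le _ _))// ler_piMr// rnorm_ge0.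
  (* Along the chain [re (f _)] increases to [sup S]. Beyond a member within [l * re e] of it, the
     order confines all later ones to a ball of radius [e]. *)
  have /cauchy_cvg Fcvg : cauchy F.
    apply: cauchy_exP => e e0; have e0' : 0 < re e.
      by rewrite -(@ofR_lt R k) ofR0 ofR_re// ltW.
    have [_ [a Aa <-] aS] := sup_adherent (mulr_gt0 l0 e0') supS.
    exists (sval a); exists a => // _ [b Ab [<- ab]].
    rewrite -ball_normE /= distrC -[e]ofR_re ?ltW// norm_lt_ofR -(ltr_pM2l l0).
    rewrite (le_lt_trans ab)//.
    have : re (f (sval b)) <= sup S by apply: ub_le_sup; [exact: supS.2|exists b].
    by lra.
  pose w := lim F.
  have near_w a e : A a -> 0 < e ->
      exists u, [/\ rnorm u <= 1, le (sval a) u, le y u & rnorm (w - u) < e].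
    move=> Aa e0.
    have we : nbhs w (ball w (ofR e)).
      by apply: nbhsx_ballx; rewrite -(@ofR0 R k) ofR_lt.
    have Fa : F (tail a) by exists a.
    have [u [[b Ab [bu au]] wu]] := filter_ex (filterI Fa (Fcvg _ we)).
    exists u; have [b1 yb] := svalP b; rewrite -bu; split => //.
      by rewrite bu.
    by move: wu; rewrite -ball_normE /= norm_lt_ofR bu.
  have w1 : rnorm w <= 1.
    apply: (le_of_le_addM ler01) => e e0.
    have [u [u1 _ _ wu]] := near_w _ _ Aa0 e0.
    by have := rnormD (w - u) u; rewrite subrK; lra.
  (* The order is closed under limits: an error [e] in the point costs at most
     [(l + rnorm f) * e]. *)
  have le_w a : (forall e, 0 < e -> exists2 u, le a u & rnorm (w - u) < e) -> le a w.
    move=> aw; apply: (@le_of_le_addM _ _ (l + rnorm f)).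
      by rewrite addr_ge0 ?rnorm_ge0// ltW.
    move=> e e0; have [u au wu] := aw _ e0.
    have := ler_wpM2l (ltW l0) (rnormD (w - u) (u - a)); rewrite subrKA mulrDr.
    have := re_dual_le f (u - w); rewrite re_dualB rnormB.
    have := ler_wpM2l (rnorm_ge0 f) (ltW wu); have := ler_wpM2l (ltW l0) (ltW wu).
    by move: au; rewrite /le mulrDl; lra.
  have yw : le y w.
    by apply: le_w => e /(near_w _ _ Aa0)[u [_ _ yu wu]]; exists u.
  exists (exist _ w (conj w1 yw)) => a Aa; apply/asboolP; apply: le_w => e.
  by move=> /(near_w _ _ Aa)[u [_ au _ wu]]; exists u.
case: z zmax => z [z1 yz] zmax; exists z; split => // u u1.
rewrite leNgt; apply/negP => zu; have zu' : le z u by exact: ltW.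
have := zmax (exist _ u (conj u1 (le_tr _ _ _ yz zu'))).
move=> /(_ (asboolT zu')) /(congr1 sval) /= uz.
by move: zu; rewrite uz !subrr rnorm0 mulr0 ltxx.
Qed.

(** Maximality of [z] lets Mazur-Orlicz produce [h] of norm at most [l] such that [f + h] attains
    its norm at [z]; [g] is [f + h] normalised. The gain of [f] from [y] to [z] is at most [l ^+ 2],
    so [z] is within [l] of [y]. *)
Lemma bishop_phelps_bollobas f (l : R) y : 0 < l -> l < 1 ->
    rnorm f = 1 -> rnorm y <= 1 -> 1 - l ^+ 2 <= re (f y) ->
  exists z g, [/\ @duality_pairs R k X (z, g), rnorm (z - y) <= l &
    rnorm (f - g) <= 2 * l].
Proof.
move=> l0 l1 f1 y1 fy; have [z [z1 yz zmax]] := bishop_phelps_point f l0 y1.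
have zy : rnorm (z - y) <= l.
  rewrite -(ler_pM2l l0) (le_trans yz)//.
  have := re_dual_le f z; rewrite f1 mul1r; lra.
(* The conic hull of the pairs [(z - w, re (f w) - re (f z))] with [w] in the unit ball; [h]
   dominating them means that [f + h] is largest at [z]. *)
pose C : set (X * R) := [set c | exists t w, [/\ 0 <= t, rnorm w <= t &
  c = (ofR t *: z - w, re (f w) - t * re (f z))]].
have coneC : cone_over C.
  split.
  - by exists 0, 0; rewrite rnorm0 ofR0 scale0r re_dual0 mul0r !subrr.
  - move=> _ _ [t [w [t0 wt ->]]] [s [v [s0 vs ->]]]; exists (t + s), (w + v).
    split; first exact: addr_ge0.
      by rewrite (le_trans (rnormD _ _))// lerD.
    rewrite /= ofRD scalerDl re_dualD mulrDl !opprD addrACA.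
    by congr (_, _); rewrite addrACA.
  - move=> s _ s0 [t [w [t0 wt ->]]]; exists (s * t), (ofR s *: w).
    split; first exact: mulr_ge0.
      by rewrite rnormZ ger0_norm// ler_wpM2l.
    by rewrite /= ofRM -scalerA -scalerBr re_dualZ -mulrA -mulrBr.
have Cl c : C c -> c.2 <= l * rnorm c.1.
  move=> [t [w [t0 wt ->]]] /=; have [t0'|tn0] := eqVneq t 0.
    have -> : w = 0.
      by apply/rnorm_eq0/eqP; rewrite eq_le rnorm_ge0 andbT -t0'.
    by rewrite t0' re_dual0 mul0r !subrr mulr_ge0 ?rnorm_ge0// ltW.
  have tp : 0 < t by rewrite lt_def tn0.
  have tK v : ofR t *: (ofR t^-1 *: v) = v :> X.
    by rewrite scalerA -ofRM mulfV// ofR1 scale1r.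
  have := zmax (ofR t^-1 *: w); rewrite rnormZ gtr0_norm ?invr_gt0//.
  rewrite ler_pdivrMl// mulr1 => /(_ wt); rewrite -(ler_pM2l tp) mulrBr -re_dualZ tK.
  move=> /le_trans; apply; rewrite rnormB mulrCA -{1}(gtr0_norm tp) -rnormZ.
  by rewrite scalerBr tK.
have [h0 [lh hl hC]] := mazur_orlicz (sublinear_rnorm X (ltW l0)) coneC Cl.
have [h hE] := dual_of_real_linear lh hl.
have hle : rnorm h <= l.
  apply: rnorm_dual_le => x x1; rewrite hE (le_trans (hl x))//.
  by rewrite ler_piMr// ltW.
pose G := f + h; pose N := rnorm G.
have GE w : re (G w) = re (f w) + re (h w) by exact: re_additive.
have Gz : N <= re (G z).
  apply: rnorm_dual_le => w w1.
  have /= := hC (ofR 1 *: z - w, re (f w) - 1 * re (f z)).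
  rewrite -hE ofR1 scale1r mul1r re_dualB => hzw.
  have : C (z - w, re (f w) - re (f z)).
    by exists 1, w; rewrite ofR1 scale1r mul1r.
  by move=> /hzw; rewrite !GE; lra.
have N1 : `|N - 1| <= l.
  have := rnormD f h; have := rnormD G (- h); rewrite addrK rnormN -/G -/N f1.
  by move=> ? ?; rewrite ler_norml; apply/andP; split; lra.
have Np : 0 < N by move: N1; rewrite ler_norml => /andP[]; lra.
have GzN : re (G z) <= N * rnorm z by exact: re_dual_le.
have z1' : rnorm z = 1.
  by apply/eqP; rewrite eq_le z1 -(ler_pM2l Np) mulr1 (le_trans Gz).
have GzE : re (G z) = N by apply/eqP; rewrite eq_le Gz (le_trans GzN)// z1' mulr1.
exists z, (ofR N^-1 *: G); split => //.
  apply: duality_pairs_re => //.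
    by rewrite rnormZ gtr0_norm ?invr_gt0// mulVf ?gt_eqF.
  by rewrite -[LHS]/(re (ofR N^-1 * G z)) re_ofRM GzE mulVf ?gt_eqF.
(* The two terms have norms [|N - 1|] and [rnorm h], each at most [l]. *)
have -> : f - ofR N^-1 *: G = ofR (1 - N^-1) *: G - h.
  by rewrite ofRD ofR1 ofRN scalerDl scale1r scaleNr addrAC {2}/G addrK.
apply: le_trans (rnormD _ _) _; rewrite rnormN rnormZ -/N.
suff -> : `|1 - N^-1| * N = `|N - 1| by lra.
by rewrite -{2}(gtr0_norm Np) -normrM mulrBl mul1r mulVf ?gt_eqF.
Qed.


End bishop_phelps.

(** * Comparison of the moduli of a space and of its dual *)

Section dual_modulus.
Variables (R : realType) (k : scalar_kind).

(** Evaluation at [x] preserves both norm and pairing, so [delta] is unchanged; general [D] and [D']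
    cover balls and spheres together. *)
Lemma bpb_approximable_dual (X : completeNormedModType (scalars R k))
    (D : set (X * dual X)) (D' : set (dual X * dual (dual X))) (delta e : R) :
    (forall x f F, D (x, f) -> rnorm F = rnorm x -> D' (f, F)) -> 0 < e ->
  bpb_approximable D' delta e -> bpb_approximable D delta e.
Proof.
move=> DD' e0 app x f Dxf fx; have [F [FE Fx]] := dual_evaluation x.
have [|g [G [[/= g1 G1 Gg]]]] := app f F (DD' _ _ _ Dxf Fx); first by rewrite FE.
rewrite !norm_lt_ofR => fg FG.
have rg1 : rnorm g = 1 by rewrite /rnorm g1 -(@ofR1 R k) ofRK.
have rG1 : rnorm G <= 1 by rewrite /rnorm G1 -(@ofR1 R k) ofRK.
have := rnorm_ge0 (F - G) => FG0.
(* The midpoint of [rnorm (F - G)] and [e] leaves room on both sides. *)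
pose r := (rnorm (F - G) + e) / 2; pose d := rnorm (f - g).
have r0 : 0 < r by rewrite /r; lra.
have r_lt_e : r < e by rewrite /r; lra.
(* The second term keeps [r * (1 + s) + s + l], the bound on the distance from [x] to [z], below
   [e], given [s <= l / 2]; the third keeps [d + 2 * l] below [e]. *)
pose l := Num.min (1 / 2) (Num.min ((e - r) / (r + 3)) ((e - d) / 4)).
have l0 : 0 < l.
  by rewrite !lt_min !divr_gt0 ?subr_gt0// addr_gt0.
have l2 : l <= 1 / 2 by rewrite ge_min lexx.
have lr : l * (r + 3) <= e - r.
  by rewrite -ler_pdivlMr ?addr_gt0// !ge_min lexx ?orbT.
have ld : l <= (e - d) / 4 by rewrite !ge_min lexx ?orbT.
have lsq : l ^+ 2 <= l by rewrite expr2 ler_piMl ?ltW//; lra.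
pose s := l ^+ 2 / 2; have s0 : 0 < s by rewrite divr_gt0 ?exprn_gt0.
have [|y [y1 yx gy]] := almost_reflexive r0 s0 rG1 Gg (x := x).
  move=> h; rewrite -FE -reB -[G h - F h]/((G - F) h).
  rewrite (le_trans (re_dual_le _ _))// ler_wpM2r ?rnorm_ge0// rnormB /r; lra.
have s1 : 0 < 1 + s by rewrite addr_gt0.
pose y' := ofR (1 + s)^-1 *: y.
have y'1 : rnorm y' <= 1.
  by rewrite rnormZ gtr0_norm ?invr_gt0// ler_pdivrMl// mulr1 ltW.
have yE : y = ofR (1 + s) *: y' by rewrite scalerA -ofRM mulfV ?gt_eqF// ofR1 scale1r.
have yy' : rnorm (y - y') <= s.
  rewrite {1}yE ofRD ofR1 scalerDl scale1r addrAC subrr add0r rnormZ gtr0_norm//.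
  by rewrite ler_piMr// ltW.
(* The loss [s] from [almost_reflexive] and the loss from rescaling total at most [2 * s], whence
   [s = l ^+ 2 / 2]. *)
have gy' : 1 - l ^+ 2 <= re (g y').
  move: gy; rewrite {1}yE re_dualZ => gy.
  rewrite -(ler_pM2l s1) (le_trans _ (ltW gy))//.
  have -> : l ^+ 2 = 2 * s by rewrite /s; lra.
  by have := sqr_ge0 s; lra.
have l1 : l < 1 by lra.
have [z [h [zh zy' gh]]] := bishop_phelps_bollobas l0 l1 rg1 y'1 gy'.
exists z, h; split => //; rewrite norm_lt_ofR.
  have := rnormD (x - y) (y - z); have := rnormD (y - y') (y' - z).
  rewrite !subrKA [rnorm (x - y)]rnormB [rnorm (y' - z)]rnormB.
  have : r * (1 + s) <= r * (1 + l / 2).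
    by rewrite ler_wpM2l ?(ltW r0)// lerD2l /s ler_pM2r ?invr_gt0.
  have : s <= l / 2 by rewrite /s ler_pM2r ?invr_gt0.
  by lra.
have := rnormD (f - g) (g - h); rewrite subrKA -/d => /le_lt_trans; apply.
by move: l0 ld gh; clearbody l d; clear; lra.
Qed.

(** Inclusion of the sets of admissible [e] reverses their infima once the smaller set is nonempty;
    the infimum of an empty set would be 0 by default. *)
Lemma bpb_modulus_on_dual (X : completeNormedModType (scalars R k))
    (D : set (X * dual X)) (D' : set (dual X * dual (dual X))) (delta : R) :
    (exists x : X, x != 0) ->
    (forall x f F, D (x, f) -> rnorm F = rnorm x -> D' (f, F)) ->
    (D' `<=` @ball_pairs R k (dual X)) ->
  bpb_modulus_on D delta <= bpb_modulus_on D' delta.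
Proof.
move=> [x x0] DD' D'ball; apply: lb_le_inf => [|e [e0 /= De]]; last first.
  apply: ge_inf; last by split => //; exact: bpb_approximable_dual De.
  by exists 0 => a [/ltW].
(* Points of a unit ball are at distance at most 2, so any duality pair of the dual will do; one
   exists because [X] is nonzero. *)
exists 3; split => // f F /D'ball[/= f1 F1] _.
have [g g1 gx] := unit_norming_functional x0.
have g0 : g != 0.
  by apply: contra_eq_neq g1 => ->; rewrite rnorm0 eq_sym oner_neq0.
have [G G1 Gg] := unit_norming_functional g0.
have near2 (V : normedModType (scalars R k)) (u v : V) :
    `|u| <= 1 -> rnorm v = 1 -> `|u - v| < ofR 3.
  rewrite -(@ofR1 R k) norm_le_ofR norm_lt_ofR => u1 v1.
  by have := rnormD u (- v); rewrite rnormN v1; lra.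
exists g, G; split; [|exact: near2..].
by apply: duality_pairs_re => //; rewrite Gg.
Qed.

End dual_modulus.

Theorem proposition3p6 (R : realType) (k : scalar_kind)
    (X : completeNormedModType (scalars R k)) (X_neq0 : exists x : X, x != 0)
    (delta : R) (delta_gt0 : 0 < delta) (delta_lt2 : delta < 2) :
  bpb_modulus X delta <= bpb_modulus (dual X) delta /\
  spherical_bpb_modulus X delta <= spherical_bpb_modulus (dual X) delta.
Proof.
split; apply: bpb_modulus_on_dual => //.
- by move=> x f F [/= x1 f1] Fx; split => //=; rewrite -ofR_rnorm Fx ofR_rnorm.
- by move=> x f F [/= x1 f1] Fx; split => //=; rewrite -ofR_rnorm Fx ofR_rnorm.
- by move=> [f F] [f1 F1]; split; [rewrite [leLHS]f1|rewrite [leLHS]F1].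
Qed.
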